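(* Let $m\ge 2$ be an integer and let $\Lambda$ be a subset of $I_2[m]$ with $|\Lambda|=r$. Then $$K_\Lambda=\tfrac12\Sigma(G_\Lambda)-r,\quad\text{or equivalently,}\quad \Sigma(G_\Lambda)=2K_\Lambda+2r.$$ Consequently, $\Lambda$ is a subclose family if and only if $G_\Lambda$ is an optimal graph. Moreover, $$\max\{\Sigma(G) : G \text{ is a simple } (m,r)\text{-graph}\}=2K_r(2,m)+2r.$$
   Context: $[m]:=\{1,\dots,m\}$, and $I_2[m]$ denotes the set of all $2$-element subsets of $[m]$. For $\Lambda=\{A_1,\dots,A_r\}\subseteq I_2[m]$ with $|\Lambda|=r$ (the $A_i$ distinct), put $K_\Lambda:=\sum_{1\le i<j\le r}|A_i\cap A_j|$. For an integer $0\le r\le\binom{m}{2}$, put $K_r(2,m):=\max\{K_\Lambda : \Lambda\subseteq I_2[m],\ |\Lambda|=r\}$. A family $\Lambda\subseteq I_2[m]$ is called subclose if $K_\Lambda=K_r(2,m)$, where $r=|\Lambda|$. $G_\Lambda$ denotes the simple undirected graph with vertex set $[m]$ and edge set $\Lambda$. An $(m,r)$-graph is a graph with vertex set $[m]$ and exactly $r$ edges. For a simple $(m,r)$-graph $G$, $g_i(G)$ is the degree of vertex $i$ and $\Sigma(G):=\sum_{i=1}^m g_i(G)^2$. A simple $(m,r)$-graph $G$ is called optimal if $\Sigma(G)$ is maximum among all simple $(m,r)$-graphs. *)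

(* Defs.v *)
(* The vertex set [m] = {1, ..., m} is the type 'I_m. *)
From HB Require Import structures.
From mathcomp Require Import all_boot all_order all_algebra.

Set Implicit Arguments.
Unset Strict Implicit.
Unset Printing Implicit Defensive.

Definition I2 (m : nat) : {set {set 'I_m}} := [set A : {set 'I_m} | #|A| == 2].

(* The members A_1, ..., A_r of L are listed by [enum_val : 'I_#|L| -> _];
   as the summand is symmetric, the value does not depend on the listing. *)
Definition K (m : nat) (L : {set {set 'I_m}}) : nat :=
  \sum_(i < #|L|) \sum_(j < #|L| | i < j)
    #|(enum_val i : {set 'I_m}) :&: enum_val j|.

(* K_r(2, m).  The range is nonempty exactly when r <= 'C(m, 2); outside it
   the value is the default 0 of \max. *)
Definition Kmax (m r : nat) : nat :=
  \max_(L : {set {set 'I_m}} | (L \subset I2 m) && (#|L| == r)) K L.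

Definition subclose (m : nat) (L : {set {set 'I_m}}) : Prop :=
  L \subset I2 m /\ K L = Kmax m #|L|.

Record sgraph (m : nat) : Type := SGraph {
  edges : {set {set 'I_m}};
  edges_sub : edges \subset I2 m
}.

HB.instance Definition _ (m : nat) := [isSub for @edges m].
HB.instance Definition _ (m : nat) := [Finite of sgraph m by <:].

Definition mr_graph (m r : nat) (G : sgraph m) : bool := #|edges G| == r.

Definition deg (m : nat) (G : sgraph m) (i : 'I_m) : nat :=
  #|[set A in edges G | i \in A]|.

Definition Sigma (m : nat) (G : sgraph m) : nat := \sum_(i < m) deg G i ^ 2.

Definition optimal (m : nat) (G : sgraph m) : Prop :=
  forall H : sgraph m, mr_graph #|edges G| H -> Sigma H <= Sigma G.

(* G_L, the graph with edge set L. *)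
Definition graph_of (m : nat) (L : {set {set 'I_m}}) (hL : L \subset I2 m) :
  sgraph m := SGraph hL.

(* Main.v *)
(* Double counting: the sum of squared degrees counts the triples (i, A, B)
   with i a common vertex of the edges A and B, so it is the sum of |A :&: B|
   over ordered pairs of edges.  The r diagonal pairs contribute 2 each, and
   the off-diagonal ones contribute 2 K by symmetry. *)
Require Import Defs.
From HB Require Import structures.
From mathcomp Require Import all_boot all_order all_algebra.

(** Each row splits at the diagonal; exchanging the two sums and using symmetry turns the part below
    the diagonal into the part above it. *)
Lemma sum_sym_ord (n : nat) (F : 'I_n -> 'I_n -> nat) :
  (forall i j, F i j = F j i) ->
  \sum_(i < n) \sum_(j < n) F i j =
  \sum_(i < n) F i i + 2 * \sum_(i < n) \sum_(j < n | i < j) F i j.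
Proof.
move=> Fsym.
have lower : \sum_(i < n) \sum_(j < n | j < i) F i j =
             \sum_(i < n) \sum_(j < n | i < j) F i j.
  rewrite (exchange_big_dep predT) //=.
  by apply: eq_bigr => i _; apply: eq_bigr => j _.
rewrite mul2n -addnn -{1}lower -!big_split /=; apply: eq_bigr => i _.
rewrite (bigID (fun j : 'I_n => j < i)) /= addnCA; congr addn.
rewrite (bigD1 i) ?ltnn //=; congr addn.
by apply: eq_bigl => j; rewrite -leqNgt ltn_neqAle andbC eq_sym.
Qed.

Lemma Sigma_sum_setI (m : nat) (G : sgraph m) :
  Sigma G = \sum_(A in edges G) \sum_(B in edges G) #|A :&: B|.
Proof.
have degE i : deg G i = \sum_(A in edges G) (i \in A).
  by rewrite /deg -sum1dep_card big_mkcondr; apply: eq_bigr => A _; case: (i \in A).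
(* The square of a sum of indicators expands over ordered pairs of edges; moving the sum over [i]
   innermost then counts common vertices. *)
transitivity (\sum_(i < m) \sum_(A in edges G) \sum_(B in edges G)
                (i \in A) * (i \in B)).
  by apply: eq_bigr => i _; rewrite -mulnn degE big_distrlr.
rewrite exchange_big; apply: eq_bigr => A _.
rewrite exchange_big; apply: eq_bigr => B _.
rewrite -sum1_card [RHS]big_mkcond; apply: eq_bigr => i _.
by rewrite inE; case: (i \in A); case: (i \in B).
Qed.

Lemma Sigma_K (m : nat) (G : sgraph m) :
  Sigma G = 2 * K (edges G) + 2 * #|edges G|.
Proof.
(* Indexing the edges by [enum_val] brings the double sum to the shape used in [K]. *)
rewrite Sigma_sum_setI big_enum_val.
under eq_bigr => i _ do rewrite big_enum_val.
rewrite sum_sym_ord; last by move=> i j; rewrite setIC.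
rewrite addnC; congr addn.
rewrite (eq_bigr (fun=> 2)) ?sum_nat_const ?card_ord 1?mulnC // => i _.
have := subsetP (edges_sub G) _ (enum_valP i).
by rewrite setIid inE => /eqP.
Qed.

Lemma leq_Kmax (m : nat) (L : {set {set 'I_m}}) :
  L \subset I2 m -> K L <= Kmax m #|L|.
Proof. by move=> hL; apply: leq_bigmax_cond; rewrite hL eqxx. Qed.

(** With the number of edges fixed, [Sigma] is an increasing affine function of [K], so both have
    the same maximizers. *)
Lemma subclose_optimal (m : nat) (L : {set {set 'I_m}}) (hL : L \subset I2 m) :
  subclose L <-> optimal (graph_of hL).
Proof.
split=> [[_ KL] H /eqP rH | optL].
  by rewrite !Sigma_K rH leq_add2r leq_mul2l /= KL -rH leq_Kmax ?edges_sub.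
split=> //; apply/eqP; rewrite eqn_leq leq_Kmax //=.
apply/bigmax_leqP => M /andP[hM rM].
have := optL (graph_of hM) rM.
by rewrite !Sigma_K /= (eqP rM) leq_add2r leq_mul2l.
Qed.

Lemma max_Sigma (m : nat) (L : {set {set 'I_m}}) : L \subset I2 m ->
  \max_(G : sgraph m | mr_graph #|L| G) Sigma G = 2 * Kmax m #|L| + 2 * #|L|.
Proof.
move=> hL; apply/eqP; rewrite eqn_leq; apply/andP; split.
  apply/bigmax_leqP => G /eqP rG.
  by rewrite Sigma_K -rG leq_add2r leq_mul2l leq_Kmax ?edges_sub.
(* [L] itself makes the range of [Kmax] nonempty, so the maximum is attained at some [M] and is not
   the default 0. *)
have [|M /andP[hM /eqP rM] KM] := @eq_bigmax_cond _
  [pred M : {set {set 'I_m}} | (M \subset I2 m) && (#|M| == #|L|)] (@K m).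
  by apply/card_gt0P; exists L; rewrite inE hL eqxx.
have -> : Kmax m #|L| = K M by rewrite -KM; apply: eq_bigl.
rewrite -rM -(Sigma_K _ (graph_of hM)).
by apply: leq_bigmax_cond; rewrite /mr_graph.
Qed.

Theorem proposition14 (m : nat) (hm : 2 <= m) (r : nat)
    (L : {set {set 'I_m}}) (hL : L \subset I2 m) (hr : #|L| = r) :
  [/\ ((K L)%:R = 2%:R^-1 * (Sigma (graph_of hL))%:R - r%:R :> rat)%R,
      Sigma (graph_of hL) = 2 * K L + 2 * r,
      subclose L <-> optimal (graph_of hL) &
      \max_(G : sgraph m | mr_graph r G) Sigma G = 2 * Kmax m r + 2 * r].
Proof.
subst r; split.
(* In [rat] the common factor 2 cancels and the subtraction is not truncated. *)
- by rewrite Sigma_K -mulnDr GRing.natrM GRing.mulKf // GRing.natrD GRing.addrK.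
- exact: Sigma_K.
- exact: subclose_optimal.
- exact: max_Sigma.
Qed.
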